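(* Let $\mathcal{H}$ be a separable complex Hilbert space. Assume that $\{f_k\}_{k=1}^{\infty}=\{T^kf_1\}_{k=0}^{\infty}$ (that is, $f_k=T^{k-1}f_1$ for all $k\ge1$) is a frame for $\mathcal{H}$ for some linear operator $T$ on $\mathcal{H}$, and let $\{g_k\}_{k=1}^{\infty}$ be a sequence in $\mathcal{H}$. Suppose that for some $\lambda_1,\lambda_2$ with $0<\lambda_1<1$ and $0<\lambda_2<1$, for any $f\in\mathcal{H}$, $$\Big|\sum_{k=1}^{\infty}c_k\langle f_k-g_k,f\rangle\Big|\le\lambda_1\Big|\sum_{k=1}^{\infty}c_k\langle f_k,f\rangle\Big|+\lambda_2\Big|\sum_{k=1}^{\infty}c_k\langle g_k,f\rangle\Big|$$ for all finite scalar sequences $\{c_k\}_{k=1}^{\infty}$. Then $\{g_k\}_{k=1}^{\infty}$ is a frame for $\mathcal{H}$ which has an operator representation form, i.e. there is a linear operator $V:\mathrm{span}\{g_k\}_{k=1}^\infty\to\mathcal{H}$ such that $\{g_k\}_{k=1}^{\infty}=\{V^{n}g_1\}_{n=0}^{\infty}$ (that is, $g_k=V^{k-1}g_1$ for all $k\ge1$).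
   Context: A finite sequence $\{c_k\}_{k=1}^\infty$ is a sequence of complex numbers with only finitely many nonzero entries. A sequence $\{f_k\}_{k=1}^\infty$ in $\mathcal{H}$ is a frame for $\mathcal{H}$ if there are constants $A,B>0$ with $A\|f\|^2\le\sum_{k=1}^\infty|\langle f,f_k\rangle|^2\le B\|f\|^2$ for all $f\in\mathcal{H}$. The linear operators $T$ and $V$ are not assumed to be bounded. *)

(* Defs.v *)
From HB Require Import structures.
From mathcomp Require Import all_boot all_order all_algebra.
From mathcomp Require Import complex.
From mathcomp Require Import all_classical all_reals all_analysis.

Set Implicit Arguments.
Unset Strict Implicit.
Unset Printing Implicit Defensive.

Import Order.TTheory GRing.Theory Num.Theory.
Import numFieldNormedType.Exports.

Local Open Scope classical_set_scope.
Local Open Scope ring_scope.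

Definition separable_space (T : topologicalType) : Prop :=
  exists D : set T, countable D /\ dense D.

(* Norms of complex normed spaces take values in [R[i]] (in its nonnegative
   real axis); [rnorm] is the same number seen in [R].  It applies to vectors
   and, with [V := R[i]], to complex scalars (modulus). *)
Definition rnorm (R : realType) (V : normedZmodType R[i]) (x : V) : R :=
  complex.Re `|x|.

(* Inner products [dot] are linear in the first argument and conjugate-linear
   in the second.  A complex Hilbert space is a complete normed space over
   [R[i]] whose norm is induced by an inner product. *)
Definition induces_norm (R : realType) (H : completeNormedModType R[i])
    (dot : {dot H for @Num.conj R[i]}) : Prop :=
  forall x : H, `|x| ^+ 2 = dot x x.

(* The sum is taken in [\bar R], so that the upper bound includes its
   convergence.  Sequences are indexed from 0: [f k] stands for f_(k+1). *)
Definition is_frame (R : realType) (H : completeNormedModType R[i])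
    (dot : {dot H for @Num.conj R[i]}) (f : nat -> H) : Prop :=
  exists A B : R, [/\ 0 < A, 0 < B &
    forall x : H,
      ((A * rnorm x ^+ 2)%:E <=
         \sum_(0 <= k <oo) (rnorm (dot x (f k)) ^+ 2)%:E)%E /\
      (\sum_(0 <= k <oo) (rnorm (dot x (f k)) ^+ 2)%:E <=
         (B * rnorm x ^+ 2)%:E)%E].

Definition finite_sequence (K : nmodType) (c : nat -> K) : Prop :=
  finite_set [set k | c k != 0].

Definition seq_span (K : pzRingType) (V : lmodType K) (g : nat -> V) : set V :=
  [set x | exists (n : nat) (c : nat -> K), x = \sum_(k < n) c k *: g k].

(* A linear operator D -> W on a subspace D of V is encoded by a total function
   on V that is linear on D; its values outside D are irrelevant. *)
Definition linear_on (K : pzRingType) (V W : lmodType K) (D : set V)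
    (L : V -> W) : Prop :=
  forall (a : K) (x y : V), D x -> D y -> L (a *: x + y) = a *: L x + L y.

(* Main.v *)
Require Import Defs.
From HB Require Import structures.
From mathcomp Require Import all_boot all_order all_algebra.
From mathcomp Require Import complex.
From mathcomp Require Import all_classical all_reals all_analysis.

Import Order.TTheory GRing.Theory Num.Theory.
Import numFieldNormedType.Exports.

Local Open Scope classical_set_scope.
Local Open Scope ring_scope.

(** Fix [x] and finite coefficients [c], and put [F := \sum_k c k *: f k] and
    [G := \sum_k c k *: g k].  The hypothesis, once the sums are pulled inside
    the inner product, reads
    [|<F, x> - <G, x>| <= lambda1 |<F, x>| + lambda2 |<G, x>|].  Because both
    constants are below 1, the triangle inequality turns it into a two-sided
    comparison [|<G, x>| <= K |<F, x>|] and [|<F, x>| <= L |<G, x>|], whose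
    constants depend neither on [x] nor on [c] ([perturbation_compare]).
    Everything follows from it.

    For the frame property, take [c] to be a unit vector: the frame
    coefficients of [f] and [g] at [x] are then comparable term by term, so
    the two series are comparable ([frame_of_comparable]).

    For the operator, let [x] vary: [F = 0] and [G = 0] are equivalent
    ([dominated_eq0]), that is, [f] and [g] satisfy the same linear relations.
    The relations of [f] are stable under the shift of indices, since [T] is
    linear and maps [f k] to [f k.+1]; hence so are those of [g].  This is
    exactly the condition for sending each [g k] to [g k.+1] to be a
    well-defined linear map on the span of [g] ([shift_operator_exists]). *)

(** * Real-valued norms *)

Lemma rnormE (R : realType) (V : normedZmodType R[i]) (x : V) :
  (rnorm x)%:C%C = `|x|.
Proof. by rewrite /rnorm RRe_real// ger0_real. Qed.

Lemma rnorm_ge0 (R : realType) (V : normedZmodType R[i]) (x : V) : 0 <= rnorm x.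
Proof. by rewrite -ler0c rnormE. Qed.

Lemma rnorm0 (R : realType) (V : normedZmodType R[i]) : rnorm (0 : V) = 0.
Proof. by rewrite /rnorm normr0. Qed.

Lemma rnorm_le0 (R : realType) (V : normedZmodType R[i]) (x : V) :
  rnorm x <= 0 -> x = 0.
Proof. by rewrite -lecR rnormE normr_le0 => /eqP. Qed.

Lemma rnorm_distC (R : realType) (V : normedZmodType R[i]) (x y : V) :
  rnorm (x - y) = rnorm (y - x).
Proof. by rewrite /rnorm distrC. Qed.

Lemma ler_rnorm_dist (R : realType) (V : normedZmodType R[i]) (x y : V) :
  rnorm x <= rnorm y + rnorm (x - y).
Proof. by rewrite -lecR rmorphD/= !rnormE -{1}(subrKC y x) ler_normD. Qed.

(** Bounding [b] by [a + (b - a)] gives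
    [|b| <= (1 + l1) |a| + l2 |b|], and [l2 < 1] allows the last term to be
    absorbed on the left. *)
Lemma perturbation_compare (R : realType) (V : normedZmodType R[i])
    (a b : V) (l1 l2 : R) : l2 < 1 ->
  rnorm (a - b) <= l1 * rnorm a + l2 * rnorm b ->
  rnorm b <= (1 + l1) / (1 - l2) * rnorm a.
Proof.
move=> l2_lt1 ab; rewrite mulrAC ler_pdivlMr ?subr_gt0//.
rewrite mulrBr mulr1 lerBlDr mulrDl mul1r -addrA [rnorm b * _]mulrC.
by apply: le_trans (ler_rnorm_dist _ _ b a) _; rewrite lerD2l rnorm_distC.
Qed.

(** * Inner products of finite combinations *)

Lemma rnorm_dotC (R : realType) (H : completeNormedModType R[i])
    (dot : {dot H for @Num.conj R[i]}) (x y : H) :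
  rnorm (dot x y) = rnorm (dot y x).
Proof. by rewrite hermC expr0 mul1r /rnorm norm_conjC. Qed.

Lemma dot_eq0 (R : realType) (H : completeNormedModType R[i])
    (dot : {dot H for @Num.conj R[i]}) (x : H) :
  induces_norm dot -> (forall y, dot x y = 0) -> x = 0.
Proof.
by move=> dotN x0; apply/eqP; rewrite -normr_eq0 -sqrf_eq0 dotN x0.
Qed.

(** Carries a linear relation from one family to another: [a] and [b] are meant
    to be combinations of the two families with the same coefficients. *)
Lemma dominated_eq0 (R : realType) (H : completeNormedModType R[i])
    (dot : {dot H for @Num.conj R[i]}) (a b : H) (M : R) :
  induces_norm dot ->
  (forall x, rnorm (dot b x) <= M * rnorm (dot a x)) -> a = 0 -> b = 0.
Proof.
move=> dotN ba a0; apply: (dot_eq0 _ _ dot) => // x; apply: rnorm_le0.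
by apply: le_trans (ba x) _; rewrite a0 linear0l rnorm0 mulr0.
Qed.

Lemma fsum_support_below (R : nzRingType) (c a : nat -> R) (n : nat) :
  (forall k, (n <= k)%N -> c k = 0) ->
  \sum_(k \in [set: nat]) c k * a k = \sum_(k < n) c k * a k.
Proof.
move=> c0; rewrite (fsbig_ord _ _ (fun k => c k * a k)); apply/esym.
apply: fsbig_widen => // k [_ /negP] /=.
by rewrite -leqNgt => /c0 ->; rewrite mul0r.
Qed.

Lemma finite_sequence_below (K : nmodType) (c : nat -> K) (n : nat) :
  (forall k, (n <= k)%N -> c k = 0) -> finite_sequence c.
Proof.
move=> c0; apply: (sub_finite_set _ (finite_II n)) => k /= /eqP.
by rewrite ltnNge; apply: contra_notN => /c0.
Qed.

(** Coefficients truncated at [n] form a finite sequence, so the scalar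
    hypothesis becomes one about the two vectors that they span.  Here [c] is
    arbitrary beyond [n], which spares finite supports from then on. *)
Lemma perturbation_span (R : realType) (H : completeNormedModType R[i])
    (dot : {dot H for @Num.conj R[i]}) (f g : nat -> H) (lambda1 lambda2 : R)
    (perturbation : forall (x : H) (c : nat -> R[i]), finite_sequence c ->
      rnorm (\sum_(k \in [set: nat]) c k * dot (f k - g k) x)
       <= lambda1 * rnorm (\sum_(k \in [set: nat]) c k * dot (f k) x)
        + lambda2 * rnorm (\sum_(k \in [set: nat]) c k * dot (g k) x))
    (n : nat) (c : nat -> R[i]) (x : H) :
  rnorm (dot (\sum_(k < n) c k *: f k) x - dot (\sum_(k < n) c k *: g k) x)
    <= lambda1 * rnorm (dot (\sum_(k < n) c k *: f k) x)
     + lambda2 * rnorm (dot (\sum_(k < n) c k *: g k) x).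
Proof.
pose d k := if (k < n)%N then c k else 0.
have d0 k : (n <= k)%N -> d k = 0 by rewrite /d ltnNge => ->.
have dotE (u : nat -> H) :
    \sum_(k \in [set: nat]) d k * dot (u k) x = dot (\sum_(k < n) c k *: u k) x.
  rewrite (fsum_support_below _ _ _ _ d0) linear_sumlz; apply: eq_bigr => k _.
  by rewrite linearZl_LR /d ltn_ord.
have := perturbation x d (finite_sequence_below _ _ _ d0).
rewrite !dotE -linearBl -sumrB.
by under eq_bigr do rewrite scalerBr.
Qed.

(** * Termwise comparable families *)

Lemma frame_sum_le (R : realType) (H : completeNormedModType R[i])
    (dot : {dot H for @Num.conj R[i]}) (f g : nat -> H) (K : R) (x : H) :
  (forall k, rnorm (dot x (g k)) <= K * rnorm (dot x (f k))) ->
  (\sum_(0 <= k <oo) (rnorm (dot x (g k)) ^+ 2)%:E <=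
   (K ^+ 2)%:E * \sum_(0 <= k <oo) (rnorm (dot x (f k)) ^+ 2)%:E)%E.
Proof.
move=> gf; rewrite -nneseriesZl; last by move=> k _; rewrite lee_fin sqr_ge0.
apply: lee_nneseries => k _; first by rewrite lee_fin sqr_ge0.
by rewrite lee_fin -exprMn lerXn2r// nnegrE ?(le_trans _ (gf k)) ?rnorm_ge0.
Qed.

Lemma frame_of_comparable (R : realType) (H : completeNormedModType R[i])
    (dot : {dot H for @Num.conj R[i]}) (f g : nat -> H) (K L : R) :
  0 < K -> 0 < L ->
  (forall x k, rnorm (dot x (g k)) <= K * rnorm (dot x (f k))) ->
  (forall x k, rnorm (dot x (f k)) <= L * rnorm (dot x (g k))) ->
  is_frame dot f -> is_frame dot g.
Proof.
move=> K0 L0 gf fg [A [B [A0 B0 AfB]]].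
exists (A / L ^+ 2), (K ^+ 2 * B); split=> [||x].
- by rewrite divr_gt0 ?exprn_gt0.
- by rewrite mulr_gt0 ?exprn_gt0.
have [Af fB] := AfB x; split.
  have := le_trans Af (frame_sum_le _ _ _ _ _ _ _ (fg x)).
  by rewrite muleC -lee_pdivrMr ?exprn_gt0// -EFinM mulrAC.
apply: le_trans (frame_sum_le _ _ _ _ _ _ _ (gf x)) _.
by rewrite -mulrA (EFinM (K ^+ 2)) lee_wpmul2l// lee_fin sqr_ge0.
Qed.

(** * The shift operator on the span of a sequence *)

Lemma sum_extend_zero (K : pzRingType) (V : lmodType K) (u : nat -> V)
    (c : nat -> K) (n m : nat) : (n <= m)%N ->
  \sum_(k < n) c k *: u k = \sum_(k < m) (if (k < n)%N then c k else 0) *: u k.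
Proof.
move=> nm; rewrite (big_ord_widen _ (fun k => c k *: u k) nm) big_mkcond.
by apply: eq_bigr => k _; case: ifP => // _; rewrite scale0r.
Qed.

Lemma sum_delta (K : pzRingType) (V : lmodType K) (u : nat -> V) (k : nat) :
  u k = \sum_(i < k.+1) (i == k :> nat)%:R *: u i.
Proof.
rewrite big_ord_recr/= eqxx scale1r big1 ?add0r// => i _.
by rewrite ltn_eqF// scale0r.
Qed.

(** The operator is obtained from its graph, the set of pairs
    [(\sum_k c k *: g k, \sum_k c k *: g k.+1)].  This graph is a linear
    subspace, so it is single-valued as soon as it contains no pair [(0, y)]
    with [y != 0], which is the hypothesis. *)
Lemma shift_operator_exists (K : pzRingType) (V : lmodType K) (g : nat -> V) :
  (forall n (c : nat -> K), \sum_(k < n) c k *: g k = 0 ->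
     \sum_(k < n) c k *: g k.+1 = 0) ->
  exists S : V -> V,
    linear_on (seq_span g) S /\ forall k : nat, g k = iter k S (g 0%N).
Proof.
move=> shift0.
pose shift_graph (x y : V) := exists n (c : nat -> K),
  x = \sum_(k < n) c k *: g k /\ y = \sum_(k < n) c k *: g k.+1.
have graphD a x y x' y' : shift_graph x y -> shift_graph x' y' ->
    shift_graph (a *: x + x') (a *: y + y').
  move=> [n [c [-> ->]]] [m [d [-> ->]]].
  exists (maxn n m), (fun k => a * (if (k < n)%N then c k else 0) +
                               (if (k < m)%N then d k else 0)).
  have comb (u : nat -> V) :
      a *: (\sum_(k < n) c k *: u k) + \sum_(k < m) d k *: u k =
      \sum_(k < maxn n m) (a * (if (k < n)%N then c k else 0) +
                           (if (k < m)%N then d k else 0)) *: u k.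
    rewrite (sum_extend_zero _ _ u c _ _ (leq_maxl n m)).
    rewrite (sum_extend_zero _ _ u d _ _ (leq_maxr n m)).
    rewrite scaler_sumr -big_split/=; apply: eq_bigr => k _.
    by rewrite scalerA scalerDl.
  by rewrite !comb; split=> //; rewrite (comb (fun k => g k.+1)).
have graph_fun x y y' : shift_graph x y -> shift_graph x y' -> y' = y.
  move=> xy xy'; have := graphD (-1) _ _ _ _ xy xy'.
  rewrite !scaleN1r addNr => -[n [c [/esym/shift0 -> /eqP]]].
  by rewrite addrC subr_eq0 => /eqP.
pose S x := xget 0 (shift_graph x).
have S_eq x y : shift_graph x y -> S x = y.
  by move=> xy; apply: xget_unique => // y'; apply: graph_fun.
have S_graph x : seq_span g x -> shift_graph x (S x).
  move=> [n [c xE]].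
  have xy : shift_graph x (\sum_(k < n) c k *: g k.+1) by exists n, c.
  by rewrite (S_eq _ _ xy).
exists S; split=> [a x y gx gy|].
  by apply: S_eq; apply: graphD; apply: S_graph.
elim=> //= k <-; apply/esym/S_eq.
exists k.+1, (fun i => (i == k)%:R).
by split; [exact: sum_delta | exact: (sum_delta _ _ (fun i => g i.+1))].
Qed.

(** * Perturbation of an operator orbit *)

Theorem proposition2p8
  (R : realType) (H : completeNormedModType R[i])
  (dot : {dot H for @Num.conj R[i]})
  (dot_norm : induces_norm dot)
  (sepH : separable_space H)
  (T : {linear H -> H}) (f g : nat -> H)
  (f_orbit : forall k : nat, f k = iter k T (f 0%N))
  (f_frame : is_frame dot f)
  (lambda1 lambda2 : R)
  (lambda1_bounds : 0 < lambda1 < 1)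
  (lambda2_bounds : 0 < lambda2 < 1)
  (perturbation : forall (x : H) (c : nat -> R[i]), finite_sequence c ->
     rnorm (\sum_(k \in [set: nat]) c k * dot (f k - g k) x)
       <= lambda1 * rnorm (\sum_(k \in [set: nat]) c k * dot (f k) x)
        + lambda2 * rnorm (\sum_(k \in [set: nat]) c k * dot (g k) x)) :
  is_frame dot g /\
  (exists V : H -> H,
     linear_on (seq_span g) V /\
     forall k : nat, g k = iter k V (g 0%N)).
Proof.
have [/andP[l1_gt0 l1_lt1] /andP[l2_gt0 l2_lt1]] :=
  (lambda1_bounds, lambda2_bounds).
pose K := (1 + lambda1) / (1 - lambda2); pose L := (1 + lambda2) / (1 - lambda1).
have K_gt0 : 0 < K by rewrite divr_gt0 ?subr_gt0// addr_gt0.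
have L_gt0 : 0 < L by rewrite divr_gt0 ?subr_gt0// addr_gt0.
have span_bound := perturbation_span _ _ _ _ _ _ _ perturbation.
have g_le_f n (c : nat -> R[i]) x : rnorm (dot (\sum_(k < n) c k *: g k) x) <=
    K * rnorm (dot (\sum_(k < n) c k *: f k) x).
  exact: (perturbation_compare _ _ _ _ _ _ l2_lt1 (span_bound n c x)).
have f_le_g n (c : nat -> R[i]) x : rnorm (dot (\sum_(k < n) c k *: f k) x) <=
    L * rnorm (dot (\sum_(k < n) c k *: g k) x).
  apply: (perturbation_compare _ _ _ _ _ _ l1_lt1).
  by rewrite rnorm_distC [leRHS]addrC; exact: span_bound.
split.
  apply: (frame_of_comparable _ _ dot f g K L) => // x k.
    rewrite !(rnorm_dotC _ _ _ x) (sum_delta _ _ g) (sum_delta _ _ f).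
    exact: (g_le_f _ (fun i => (i == k)%:R)).
  rewrite !(rnorm_dotC _ _ _ x) (sum_delta _ _ g) (sum_delta _ _ f).
  exact: (f_le_g _ (fun i => (i == k)%:R)).
apply: shift_operator_exists => n c g0.
have f0 := dominated_eq0 _ _ _ _ _ _ dot_norm (f_le_g n c) g0.
have Tf0 : \sum_(k < n) c k *: f k.+1 = 0.
  have := congr1 T f0; rewrite raddf_sum raddf0; apply: etrans.
  by apply: eq_bigr => k _; rewrite [RHS]linearZ/= (f_orbit k.+1) (f_orbit k).
(* A combination of the shifted family is a combination of the family itself
   whose coefficients start with a zero. *)
pose d k := if k is k'.+1 then c k' else 0.
have shiftE (u : nat -> H) :
    \sum_(k < n) c k *: u k.+1 = \sum_(k < n.+1) d k *: u k.
  by rewrite big_ord_recl scale0r add0r.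
rewrite shiftE; apply: (dominated_eq0 _ _ _ _ _ _ dot_norm (g_le_f n.+1 d)).
by rewrite -shiftE.
Qed.
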